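(* Let $G$ be a finite $\mathcal{DC}$-group. Then: (1) $G$ is solvable. (2) There is a prime $p$ such that $G=P\rtimes A$, where $P$ is a Sylow $p$-subgroup of $G$ (normal in $G$) and $A$ is an abelian $p'$-subgroup of $G$.
   Context: For a group $H$, $H'$ denotes its derived (commutator) subgroup. A group $G$ is called a $\mathcal{DC}$-group if the set $\{H' \mid H\leq G\}$ is a chain with respect to inclusion, i.e. for all subgroups $H,K\leq G$ one has $H'\leq K'$ or $K'\leq H'$. A $p'$-subgroup is a subgroup whose order is not divisible by $p$. The notation $P\rtimes A$ means the (internal) semidirect product with normal factor $P$. *)

(* Defs.v *)
From mathcomp Require Import all_boot all_fingroup all_solvable.
Set Implicit Arguments.
Unset Strict Implicit.
Unset Printing Implicit Defensive.

Local Open Scope group_scope.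

(* The derived subgroups of the subgroups of G form a chain under inclusion. *)
Definition DC_group (gT : finGroupType) (G : {group gT}) : Prop :=
  forall H K : {group gT}, H \subset G -> K \subset G ->
    H^`(1) \subset K^`(1) \/ K^`(1) \subset H^`(1).

(* Main.v *)
(* The chain condition makes conjugate derived subgroups equal, so H' is normal
   in G for every H <= G; DC passes to subgroups and quotients.  A minimal
   nonsolvable DC-group would thus be simple with all proper subgroups abelian,
   and its maximal subgroups would be Frobenius complements, which is absurd.

   Both semidirect factors come from showing, by induction on |G|, that G' is a
   p-group for some p.  If G is nonabelian, some K <= G has D = K' a nontrivial
   p-group, and G'/D is a q-group by induction.  Suppose q <> p and let R be a
   Sylow q-subgroup of G'.  By the Frattini argument G = D N_G(R), and induction
   reduces to R normal in G.  For x in G the derived subgroup of R<x> is a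
   q-group comparable with D, hence trivial: R is central in G.  So G/D is
   nilpotent with abelian Sylow q-subgroups and (G/D)' a q-group, whence G/D is
   abelian and G' = D. *)

Require Import Defs.
From mathcomp Require Import all_boot all_fingroup all_solvable.
From mathcomp Require Import vcharacter.
Local Open Scope group_scope.

Lemma DC_groupS (gT : finGroupType) (G H : {group gT}) :
  H \subset G -> DC_group G -> DC_group H.
Proof.
move=> sHG dcG K L sKH sLH.
exact: dcG (subset_trans sKH sHG) (subset_trans sLH sHG).
Qed.

Lemma DC_group_quotient (gT : finGroupType) (G N : {group gT}) :
  N <| G -> DC_group G -> DC_group (G / N)%G.
Proof.
move=> nsNG dcG Kq Lq sKq sLq.
have [K defK _ sKG] := inv_quotientS nsNG sKq.
have [L defL _ sLG] := inv_quotientS nsNG sLq.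
have nNG := normal_norm nsNG.
rewrite defK defL -!quotient_der ?(subset_trans sKG) ?(subset_trans sLG) //.
by case: (dcG K L sKG sLG) => sKL; [left | right]; exact: quotientS.
Qed.

Lemma DC_der1_normal (gT : finGroupType) (G H : {group gT}) :
  DC_group G -> H \subset G -> H^`(1) <| G.
Proof.
move=> dcG sHG; rewrite /normal (subset_trans (der_sub 1 H)) //=.
apply/subsetP=> x Gx; rewrite inE -derJ.
have sHxG: (H :^ x)%G \subset G by rewrite /= -(conjGid Gx) conjSg.
have [sHHx|//] := dcG H (H :^ x)%G sHG sHxG.
suffices /eqP-> : H^`(1) == (H :^ x)%G^`(1) by [].
by rewrite eqEcard sHHx /= derJ cardJg.
Qed.

(* If G were not abelian, a maximal subgroup would be a Frobenius complement
   with abelian quotient by its kernel. *)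
Lemma simple_proper_abelian (gT : finGroupType) (G : {group gT}) :
    simple G -> (forall H : {group gT}, H \proper G -> abelian H) ->
  abelian G.
Proof.
move=> simG abS; apply: contraT => nabG.
have [ntG simpleG] := simpleP _ simG.
have Z1: 'Z(G) = 1.
  have [//|ZG] := simpleG _ (center_normal G).
  by case/negP: nabG; rewrite -ZG center_abelian.
have [x Gx ntx] := trivgPn _ ntG.
have sxG: <[x]> \subset G by rewrite cycle_subG.
have pxG: <[x]>%G \proper G.
  rewrite properEneq sxG andbT; apply: contraNneq nabG => <-.
  exact: cycle_abelian.
have [M maxM sxM] := maxgroup_exists (gP := fun H => H \proper G) pxG.
have [pMG maxM'] := maxgroupP maxM; have sMG := proper_sub pMG.
have ntM: M :!=: 1.
  by apply/trivgPn; exists x; rewrite // -cycle_subG.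
(* Simplicity keeps [M] from being normal in [G], so maximality of [M] applies to its normalizer. *)
have NM: 'N_G(M) = M.
  have [pN|] := boolP ('N_G(M)%G \proper G).
    by apply: maxM'; rewrite // subsetI sMG normG.
  rewrite properE subsetIl negbK subsetI subxx => nMG.
  have [|defM|defM] := simpleG M; first by rewrite /normal sMG.
    by rewrite defM eqxx in ntM.
  by rewrite defM properxx in pMG.
have frobM: [Frobenius G with complement M].
  rewrite /Frobenius_group_with_complement proper_neq //=.
  apply/normedTI_P; split; first by rewrite setD_eq0 subG1.
    by rewrite subsetI sMG normD1 normG.
  move=> g Gg; rewrite -setI_eq0 => /set0Pn[y].
  rewrite conjD1g !inE => /andP[/andP[nty My] /andP[_ Mgy]].
  rewrite -NM inE Gg inE; apply: contraR nty => nMg.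
  have sMgG: M :^ g \subset G by rewrite -(conjGid Gg) conjSg.
  (* Two distinct conjugates of [M] generate [G] and are abelian, so a common element is central,
     hence trivial. *)
  have defG: M <*> M :^ g = G.
    apply/eqP; rewrite eqEproper join_subG sMG sMgG /=.
    apply: contra nMg => pJ.
    by rewrite -{2}(maxM' _ pJ (joing_subl _ _)) joing_subr.
  suffices: y \in 'Z(G) by rewrite Z1 inE.
  rewrite inE (subsetP sMG) //= -defG centY inE.
  rewrite (subsetP (abS _ pMG)) // (subsetP (_ : abelian (M :^ g))) //.
  by rewrite abelianJ abS.
(* Frobenius's theorem yields a normal kernel, nontrivial and proper, against simplicity. *)
have [K frobK] := Frobenius_kernel_exists frobM.
have [/sdprodP[_ defG nKM _] ntK _ pKG _] := Frobenius_context frobK.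
have [|K1|KG] := simpleG K.
- by rewrite /normal proper_sub //= -defG mulG_subG normG.
- by rewrite K1 eqxx in ntK.
- by rewrite KG properxx in pKG.
Qed.

Lemma DC_solvable (gT : finGroupType) (G : {group gT}) :
  DC_group G -> solvable G.
Proof.
have [n] := ubnP #|G|; elim: n => // n IHn in gT G * => leGn dcG.
have [-> | ntG] := eqsVneq G 1; first exact: solvable1.
(* If the minimal normal subgroup [M] is proper, induction applies to [M] and [G / M]; otherwise [G]
   is simple. *)
have [M minM sMG] := minnormal_exists ntG (normG G).
have [pMG | ] := boolP (M \proper G).
  have [/andP[ntM nMG] _] := mingroupP minM.
  have nsMG : M <| G by rewrite /normal sMG.
  rewrite (series_sol nsMG) !IHn //.
  - exact: leq_trans (ltn_quotient ntM sMG) _.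
  - exact: DC_group_quotient.
  - exact: leq_trans (proper_card pMG) _.
  - exact: DC_groupS sMG dcG.
rewrite properEneq sMG andbT negbK => /eqP defM.
have simG: simple G by rewrite /simple -{1}defM.
apply: abelian_sol; apply: (simple_proper_abelian _ _ simG) => H pHG.
have [_ simpleG] := simpleP _ simG.
apply/derG1P.
have [//|defH] := simpleG _ (DC_der1_normal _ _ _ dcG (proper_sub pHG)).
by case/negP: (proper_subn pHG); rewrite -{1}defH /= der_sub.
Qed.

(** The quotient by [H] is cyclic. This produces subgroups whose derived subgroup lies in a chosen
    p-group. *)
Lemma der1_joing_cycle (gT : finGroupType) (H : {group gT}) (x : gT) :
  x \in 'N(H) -> (H <*> <[x]>)^`(1) \subset H.
Proof.
move=> nHx; have nHX: <[x]> \subset 'N(H) by rewrite cycle_subG.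
apply: der1_min; first by rewrite join_subG normG.
by rewrite quotientYidl // quotient_abelian ?cycle_abelian.
Qed.

(** A minimal nonabelian subgroup [H] has abelian derived subgroup. If that is central, [H] is a
    p-group and [K] is [H]; otherwise some Sylow subgroup [P] of it is normal but not central in
    [H], and [K] is [P] extended by an element not centralizing it. *)
Lemma der1_pgroup_subgroup (gT : finGroupType) (G : {group gT}) :
    solvable G -> ~~ abelian G ->
  exists p (K : {group gT}),
    [/\ prime p, K \subset G, K^`(1) != 1 & p.-group K^`(1)].
Proof.
move=> solG nabG.
have [H minH sHG] := mingroup_exists (gP := fun H => ~~ abelian H) nabG.
have [nabH minH'] := mingroupP minH.
have abS (K : {group gT}) : K \proper H -> abelian K.
  move=> pKH; apply: contraLR (pKH) => nabK.
  by rewrite (minH' K nabK (proper_sub pKH)) properxx.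
have ntH: H :!=: 1 by apply: contraNneq nabH => ->; exact: abelian1.
have pDH := sol_der1_proper solG sHG ntH.
have abD: abelian H^`(1)%G := abS _ pDH.
have [cDH | ncDH] := boolP (H^`(1) \subset 'C(H)).
  have nilH: nilpotent H.
    rewrite -quotient_center_nil abelian_nil // sub_der1_abelian //.
    by rewrite subsetI cDH der_sub.
  have ltH: 1 < #|H| by rewrite cardG_gt1.
  (* Were [H] not a p-group, it would be the product of its commuting p- and p'-cores, both proper
     and so abelian; the p'-core is proper because [p] divides the order of [H]. *)
  set p := pdiv #|H|; have p_pr: prime p by exact: pdiv_prime.
  exists p, H; split=> //; first by apply: contraNneq nabH => /derG1P.
  apply: pgroupS (der_sub 1 H) _.
  apply: contraR nabH => npH.
  have /dprodP[_ defH cOO _] := nilpotent_pcoreC p nilH.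
  rewrite -defH abelianM cOO andbT !abS // properEneq pcore_sub andbT.
    apply: contraL (pdiv_dvd #|H|) => /eqP eqOH.
    have: p^'.-group H by rewrite -eqOH pcore_pgroup.
    by rewrite p'groupEpi mem_primes p_pr cardG_gt0.
  by apply: contraNneq npH => <-; exact: pcore_pgroup.
move: ncDH; rewrite -(Sylow_gen H^`(1)%G) gen_subG.
case/subsetPn=> y /bigcupP[P /SylowP[p p_pr sylP] Py] ncy.
have sPD := pHall_sub sylP; have sPH := subset_trans sPD (der_sub 1 H).
have nPH: H \subset 'N(P).
  have nsPD: P <| H^`(1)%G by rewrite -sub_abelian_normal.
  rewrite -(normal_Hall_pcore sylP nsPD).
  exact: char_norm_trans (pcore_char _ _) (der_norm _ _).
have [x Hx ncxy]: exists2 x, x \in H & x \notin 'C[y].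
  by apply/subsetPn; rewrite sub_cent1.
have sPX: (P <*> <[x]>)^`(1) \subset P.
  by rewrite der1_joing_cycle // (subsetP nPH).
exists p, (P <*> <[x]>)%G; split=> //.
- by rewrite join_subG (subset_trans sPH) // cycle_subG (subsetP sHG).
- apply: contra ncxy => /eqP/derG1P/centsP abPX; apply/cent1P.
  apply: abPX; first by rewrite (subsetP (joing_subr _ _)) ?cycle_id.
  exact: (subsetP (joing_subl _ _)).
- exact: pgroupS sPX (pHall_pgroup sylP).
Qed.

(** The p'-core has a derived subgroup that is both a p-group and a p'-group, hence trivial. *)
Lemma nilpotent_Sylow_abelian (p : nat) (gT : finGroupType)
    (G P : {group gT}) :
  nilpotent G -> p.-Sylow(G) P -> abelian P -> p.-group G^`(1) -> abelian G.
Proof.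
move=> nilG sylP abP pG1.
have /dprodP[_ defG cOO _] := nilpotent_pcoreC p nilG.
have defP: P :=: 'O_p(G).
  by rewrite (eq_Hall_pcore _ sylP) ?nilpotent_pcore_Hall.
rewrite -defG abelianM cOO /= -defP abP andbT.
apply/derG1P; apply: card1_trivg; apply: (@pnat_1 p).
  exact: pgroupS (dergS 1 (pcore_sub _ _)) pG1.
exact: pgroupS (der_sub 1 _) (pcore_pgroup _ _).
Qed.

Lemma DC_der1_pgroup (gT : finGroupType) (G : {group gT}) :
  DC_group G -> exists2 p, prime p & p.-group G^`(1).
Proof.
have [n] := ubnP #|G|; elim: n => // n IHn in gT G * => leGn dcG.
have [abG | nabG] := boolP (abelian G).
  (* The derived subgroup is trivial, so any prime will do. *)
  by exists 2; rewrite // (derG1P abG) pgroup1.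
have [p [K [p_pr sKG ntD pD]]] :=
  der1_pgroup_subgroup _ _ (DC_solvable _ _ dcG) nabG.
set D := (K^`(1))%G in ntD pD.
have nsDG: D <| G := DC_der1_normal _ _ _ dcG sKG.
have [sDG nDG] := andP nsDG.
(* [D] and the derived subgroup of [H] have coprime orders yet are comparable, so one is trivial,
   and [D] is not. *)
have not_sD q (H : {group gT}) :
  q != p -> prime q -> H \subset G -> q.-group H^`(1) -> abelian H.
  move=> neq_qp q_pr sHG qH.
  have TI: coprime #|D| #|H^`(1)|.
    apply: pnat_coprime pD _; apply: sub_in_pnat qH => r _ /eqnP->.
    by rewrite !inE.
  have [sDH | sHD] := dcG _ _ sKG sHG.
    by case/eqP: ntD; rewrite -(setIidPl sDH) coprime_TIg.
  by apply/derG1P; rewrite -(setIidPr sHD) coprime_TIg.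
have [q q_pr] : exists2 q, prime q & q.-group (G / D)^`(1).
  apply: IHn (DC_group_quotient _ _ _ nsDG dcG).
  exact: leq_trans (ltn_quotient ntD sDG) _.
rewrite -quotient_der // => qGD.
have [eq_qp | neq_qp] := eqVneq q p.
  exists p => //; rewrite -(pquotient_pgroup pD) -?eq_qp //.
  exact: subset_trans (der_sub 1 G) nDG.
have nDG1 := subset_trans (der_sub 1 G) nDG.
have pG1I: p.-group (G^`(1) / D) -> p.-group G^`(1).
  by rewrite (pquotient_pgroup pD nDG1).
have sDG1: D \subset G^`(1) by exact: dergS.
have [R sylR] := Sylow_exists q G^`(1)%G.
have [sRG1 qR _] := and3P sylR.
have sRG := subset_trans sRG1 (der_sub 1 G).
have nDR := subset_trans sRG nDG.
have defG1q: R / D = G^`(1) / D.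
  exact: (pHall_id (quotient_pHall nDR sylR) qGD).
have defG1: D * R = G^`(1).
  by rewrite -quotientK // defG1q quotientK // mulSGid.
have defG: D * 'N_G(R) = G.
  have /= := Frattini_arg (der_normal 1 G) sylR.
  by rewrite -defG1 -mulgA mulSGid // subsetI sRG normG.
(* A proper normalizer has a p-group as derived subgroup, by induction and [not_sD]. It maps onto
   [G / D], so G'/D, and with it G', is a p-group. *)
have [pN | ] := boolP ('N_G(R)%G \proper G).
  have [r r_pr rN] : exists2 r, prime r & r.-group 'N_G(R)%G^`(1).
    apply: IHn (DC_groupS _ _ _ (subsetIl _ _) dcG).
    exact: leq_trans (proper_card pN) _.
  have pN1: p.-group 'N_G(R)%G^`(1).
    have [<- // | neq_rp] := eqVneq r p.
    by rewrite (derG1P (not_sD _ _ neq_rp r_pr (subsetIl _ _) rN)) pgroup1.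
  exists p => //; apply: pG1I.
  rewrite quotient_der // -{1}defG quotientMidl -quotient_der.
    exact: quotient_pgroup.
  exact: subset_trans (subsetIl _ _) nDG.
rewrite properE subsetIl negbK subsetI subxx /= => nRG.
have cRG: R \subset 'C(G).
  apply/centsP=> y Ry x Gx.
  have sRX: (R <*> <[x]>)^`(1) \subset R.
    by rewrite der1_joing_cycle // (subsetP nRG).
  have abX: abelian (R <*> <[x]>)%G.
    apply: not_sD neq_qp q_pr _ (pgroupS sRX qR).
    by rewrite join_subG sRG cycle_subG.
  apply: (centsP abX); last by rewrite (subsetP (joing_subr _ _)) ?cycle_id.
  exact: (subsetP (joing_subl _ _)).
exists p => //; apply: pgroupS pD; apply: der1_min => //.
(* The derived subgroup of [G / D] is the image of the central subgroup [R]. *)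
have nilGD: nilpotent (G / D).
  rewrite -quotient_center_nil abelian_nil // sub_der1_abelian //.
  rewrite -quotient_der // -defG1q subsetI quotientS //=.
  exact: quotient_cents.
have [Q sylQ] := Sylow_exists q G.
have sQG := pHall_sub sylQ.
have sylQD := quotient_pHall (subset_trans sQG nDG) sylQ.
apply: nilpotent_Sylow_abelian nilGD sylQD _ _.
  rewrite quotient_abelian // (not_sD q) //.
  exact: pgroupS (der_sub 1 Q) (pHall_pgroup sylQ).
by rewrite -quotient_der.
Qed.

Theorem theorem3p2 (gT : finGroupType) (G : {group gT}) (hG : DC_group G) :
  solvable G /\
  exists (p : nat) (P A : {group gT}),
    [/\ prime p, p.-Sylow(G) P, P ><| A = G, abelian A & p^'.-group A].
Proof.
split; first exact: DC_solvable.
have [p p_pr pG1] := DC_der1_pgroup _ _ hG.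
have [P sylP] := Sylow_exists p G.
have sPG := pHall_sub sylP.
(* A normal p-subgroup lies in every Sylow p-subgroup. Containing G', [P] is normal with abelian
   quotient, to which any complement is isomorphic. *)
have sG1P: G^`(1) \subset P.
  exact: normal_sub_max_pgroup (Hall_max sylP) pG1 (der_normal 1 G).
have nsPG: P <| G := sub_der1_normal sG1P sPG.
have /splitsP[A complA] := SchurZassenhaus_split (pHall_Hall sylP) nsPG.
have defG: P ><| A = G.
  by apply/sdprod_normal_complP; rewrite // complgC.
exists p, P, A; split=> //.
  by rewrite (isog_abelian (sdprod_isog defG)) sub_der1_abelian.
have [_ _ hallP] := and3P sylP; rewrite /pgroup.
by rewrite (index_sdprod defG).
Qed.
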